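(* The Bannai-Ito operator $H$ with real parameters $\rho_1,\rho_2,r_1,r_2$ has 8 sequences of quasi-polynomial eigenfunctions $\{\xi_d(x)p^{(d)}_m(x)\}_{m=0}^\infty$, $d\in\{1,\ldots,8\}$. The 8 gauge factors are $$\xi_1(x)=1,$$ $$\xi_2(x)=\frac{\Gamma(\frac12+r_1+x)\Gamma(\frac12+r_1-x)\Gamma(\frac12+r_2+x)\Gamma(\frac12+r_2-x)}{\Gamma(\rho_1-x)\Gamma(1+\rho_1+x)\Gamma(\rho_2-x)\Gamma(1+\rho_2+x)},$$ $$\xi_3(x)=\frac{1}{\Gamma(\rho_1-x)\Gamma(1+\rho_1+x)\Gamma(\rho_2-x)\Gamma(1+\rho_2+x)},$$ $$\xi_4(x)=\Gamma(\tfrac12+r_1+x)\Gamma(\tfrac12+r_1-x)\Gamma(\tfrac12+r_2+x)\Gamma(\tfrac12+r_2-x),$$ $$\xi_5(x)=\frac{\Gamma(\frac12+r_1+x)\Gamma(\frac12+r_1-x)}{\Gamma(\rho_1-x)\Gamma(1+\rho_1+x)},\qquad \xi_6(x)=\frac{\Gamma(\frac12+r_2+x)\Gamma(\frac12+r_2-x)}{\Gamma(\rho_2-x)\Gamma(1+\rho_2+x)},$$ $$\xi_7(x)=\frac{\Gamma(\frac12+r_1+x)\Gamma(\frac12+r_1-x)}{\Gamma(\rho_2-x)\Gamma(1+\rho_2+x)},\qquad \xi_8(x)=\frac{\Gamma(\frac12+r_2+x)\Gamma(\frac12+r_2-x)}{\Gamma(\rho_1-x)\Gamma(1+\rho_1+x)},$$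 and the polynomial parts are $p^{(d)}_m(x)=B_m(x;\sigma_d)$ for $m\in\{0,1,2,\ldots\}$, $d\in\{1,\ldots,8\}$. Moreover, $H[\xi_d(x)p^{(d)}_m(x)]=\mu_{d,m}\,\xi_d(x)p^{(d)}_m(x)$ with eigenvalue $$\mu_{d,m}=\begin{cases}\lambda_m(\sigma_d)+C_d,& d\in\{1,2,3,4\},\\ -\lambda_m(\sigma_d)+C_d,& d\in\{5,6,7,8\},\end{cases}$$ where, writing $\sigma_d=\{\rho'_1,\rho'_2,r'_1,r'_2\}$ (in this order), $$C_d=\begin{cases}-\dfrac{\rho_1+\rho_2-\rho'_1-\rho'_2}{2}+\dfrac{r_1+r_2-r'_1-r'_2}{2},& d\in\{1,2,3,4\},\\[2mm] -\dfrac{\rho_1+\rho_2+\rho'_1+\rho'_2}{2}+\dfrac{r_1+r_2+r'_1+r'_2-1}{2},& d\in\{5,6,7,8\}.\end{cases}$$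
   Context: Operators act by $R[f(x)]=f(-x)$, $T[f(x)]=f(x+1)$, $I[f(x)]=f(x)$, so $TR[f(x)]=f(-x-1)$. The Bannai-Ito operator with parameters $(\rho_1,\rho_2,r_1,r_2)$ is $H=H(\rho_1,\rho_2,r_1,r_2)=\alpha(x)(R-I)+\beta(x)(TR-I)$ with $$\alpha(x)=\frac{(x-\rho_1)(x-\rho_2)}{-2x},\qquad \beta(x)=\frac{(x-r_1+1/2)(x-r_2+1/2)}{2x+1}.$$ The Bannai-Ito polynomial $B_n(x)=B_n(x;\rho_1,\rho_2,r_1,r_2)$ is the monic polynomial of degree $n$ with $H[B_n(x)]=\lambda_nB_n(x)$, where $\lambda_n=n/2$ for $n$ even and $\lambda_n=r_1+r_2-\rho_1-\rho_2-\frac{n+1}{2}$ for $n$ odd (parameters are assumed to be such that these polynomials are uniquely determined). For a parameter list $\sigma=\{\rho'_1,\rho'_2,r'_1,r'_2\}$, $B_n(x;\sigma)$ and $\lambda_n(\sigma)$ denote the polynomial and eigenvalue with $(\rho_1,\rho_2,r_1,r_2)$ replaced by $(\rho'_1,\rho'_2,r'_1,r'_2)$. The lists are $$\sigma_1=\{\rho_1,\rho_2,r_1,r_2\},\ \sigma_2=\{-\rho_1,-\rho_2,-r_1,-r_2\},\ \sigma_3=\{-\rho_1,-\rho_2,r_1,r_2\},\ \sigma_4=\{\rho_1,\rho_2,-r_1,-r_2\},$$ $$\sigma_5=\{-\rho_1,\rho_2,-r_1,r_2\},\ \sigma_6=\{\rho_1,-\rho_2,r_1,-r_2\},\ \sigma_7=\{\rho_1,-\rho_2,-r_1,r_2\},\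 \sigma_8=\{-\rho_1,\rho_2,r_1,-r_2\}.$$ A quasi-polynomial eigenfunction of $H$ is an eigenfunction of the form $\xi(x)p(x)$ with $p$ a polynomial; $\xi$ is called its gauge factor. *)

(* Defs.v *)
From mathcomp Require Import all_boot all_order all_algebra.
From mathcomp Require Import all_classical all_reals all_analysis.
From mathcomp Require Import complex.

Set Implicit Arguments.
Unset Strict Implicit.
Unset Printing Implicit Defensive.

Import Order.TTheory GRing.Theory Num.Theory.
Import numFieldNormedType.Exports.

Local Open Scope classical_set_scope.
Local Open Scope ring_scope.
Local Open Scope complex_scope.

(* The parameters are real; the variable x is complex, so that every function
   below is a (meromorphic) function on R[i]. *)

Section Gamma.
Variable R : realType.
Implicit Types z : R[i].

Definition cexp z : R[i] :=
  (expR (complex.Re z) * cos (complex.Im z)) +i*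
  (expR (complex.Re z) * sin (complex.Im z)).

(* The n-th term n! n^z / (z (z + 1) ... (z + n)) of Gauss's product formula
   for Gamma. *)
Definition Gamma_seq z (n : nat) : R[i] :=
  (n`!)%:R * cexp (z * (ln n%:R)%:C) / \prod_(k < n.+1) (z + k%:R).

Definition Gamma_pole z : Prop := exists k : nat, z = - k%:R.

(* The limit is taken componentwise.  At a pole z the terms are eventually 0
   because 0^-1 = 0, so Gamma z = 0 and (Gamma z)^-1 = 0, which is the value
   there of the entire function 1 / Gamma. *)
Definition Gamma z : R[i] :=
  limn (fun n => complex.Re (Gamma_seq z n)) +i*
  limn (fun n => complex.Im (Gamma_seq z n)).

End Gamma.

Section BannaiIto.
Variable R : realType.
Implicit Types (f : R[i] -> R[i]) (x : R[i]) (p : {poly R[i]}).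

Record params := Params { rho1 : R; rho2 : R; r1 : R; r2 : R }.
Implicit Type s : params.

Definition reflect_op f : R[i] -> R[i] := fun x => f (- x).
Definition shift_op f : R[i] -> R[i] := fun x => f (x + 1).

Definition BI_alpha s x : R[i] :=
  (x - (rho1 s)%:C) * (x - (rho2 s)%:C) / (- 2 * x).

Definition BI_beta s x : R[i] :=
  (x - (r1 s)%:C + 1 / 2) * (x - (r2 s)%:C + 1 / 2) / (2 * x + 1).

Definition BI_op s f : R[i] -> R[i] := fun x =>
  BI_alpha s x * (reflect_op f x - f x) +
  BI_beta s x * (shift_op (reflect_op f) x - f x).

(* The points at which the coefficients of H have no pole. *)
Definition BI_regular x : Prop := x <> 0 /\ x <> - (1 / 2).

Definition BI_lambda s (n : nat) : R :=
  if odd n then r1 s + r2 s - rho1 s - rho2 s - n.+1%:R / 2 else n%:R / 2.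

Definition is_BI_poly s (n : nat) p : Prop :=
  [/\ p \is monic, size p = n.+1 &
    forall x, BI_regular x ->
      BI_op s (fun y => p.[y]) x = (BI_lambda s n)%:C * p.[x]].

Definition BI_poly s (n : nat) : {poly R[i]} := xget 0 [set p | is_BI_poly s n p].

Definition BI_well_defined s : Prop :=
  forall n : nat, exists! p, is_BI_poly s n p.

(* In the functions of d below, only 1 <= d <= 8 is meaningful. *)
Definition sigma s (d : nat) : params :=
  let: Params a b c e := s in
  match d with
  | 1 => Params a b c e
  | 2 => Params (- a) (- b) (- c) (- e)
  | 3 => Params (- a) (- b) c e
  | 4 => Params a b (- c) (- e)
  | 5 => Params (- a) b (- c) e
  | 6 => Params a (- b) c (- e)
  | 7 => Params a (- b) (- c) e
  | 8 => Params (- a) b c (- e)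
  | _ => s
  end.

Definition gauge_num (r : R) x : R[i] :=
  Gamma (1 / 2 + r%:C + x) * Gamma (1 / 2 + r%:C - x).

Definition gauge_den (rho : R) x : R[i] :=
  Gamma (rho%:C - x) * Gamma (1 + rho%:C + x).

Definition gauge s (d : nat) x : R[i] :=
  match d with
  | 1 => 1
  | 2 => gauge_num (r1 s) x * gauge_num (r2 s) x /
         (gauge_den (rho1 s) x * gauge_den (rho2 s) x)
  | 3 => 1 / (gauge_den (rho1 s) x * gauge_den (rho2 s) x)
  | 4 => gauge_num (r1 s) x * gauge_num (r2 s) x
  | 5 => gauge_num (r1 s) x / gauge_den (rho1 s) x
  | 6 => gauge_num (r2 s) x / gauge_den (rho2 s) x
  | 7 => gauge_num (r1 s) x / gauge_den (rho2 s) x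
  | 8 => gauge_num (r2 s) x / gauge_den (rho1 s) x
  | _ => 0
  end.

Definition gauge_num_defined (r : R) x : Prop :=
  ~ Gamma_pole (1 / 2 + r%:C + x) /\ ~ Gamma_pole (1 / 2 + r%:C - x).

(* Only the Gamma factors in the numerator restrict the domain of a gauge
   factor: 1 / Gamma is entire. *)
Definition gauge_defined s (d : nat) x : Prop :=
  match d with
  | 2 | 4 => gauge_num_defined (r1 s) x /\ gauge_num_defined (r2 s) x
  | 5 | 7 => gauge_num_defined (r1 s) x
  | 6 | 8 => gauge_num_defined (r2 s) x
  | _ => True
  end.

(* f is a function with domain D and f is an eigenfunction of H: it is not
   identically zero, and the eigenvalue equation holds wherever both of its
   sides are defined. *)
Definition BI_eigenfunction s (D : set R[i]) f (mu : R) : Prop :=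
  (exists2 x, D x & f x <> 0) /\
  forall x, BI_regular x -> D x -> D (- x) -> D (- x - 1) ->
    BI_op s f x = mu%:C * f x.

Definition eigenvalue_const s (d : nat) : R :=
  let s' := sigma s d in
  if (d <= 4)%N then
    - ((rho1 s + rho2 s - rho1 s' - rho2 s') / 2)
    + (r1 s + r2 s - r1 s' - r2 s') / 2
  else
    - ((rho1 s + rho2 s + rho1 s' + rho2 s') / 2)
    + (r1 s + r2 s + r1 s' + r2 s' - 1) / 2.

Definition quasi_eigenvalue s (d m : nat) : R :=
  if (d <= 4)%N then BI_lambda (sigma s d) m + eigenvalue_const s d
  else - BI_lambda (sigma s d) m + eigenvalue_const s d.

End BannaiIto.

(* Main.v *)
Require Import Defs.
From mathcomp Require Import all_boot all_order all_algebra.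
From mathcomp Require Import all_classical all_reals all_analysis.
From mathcomp Require Import complex.
From mathcomp Require Import ring lra.

Set Implicit Arguments.
Unset Strict Implicit.
Unset Printing Implicit Defensive.

Import Order.TTheory GRing.Theory Num.Theory.
Import numFieldNormedType.Exports.

(** The operator H acts on xi * p through the two quotients xi(-x) / xi(x) and
    xi(-x-1) / xi(x).  By Gamma(z+1) = z Gamma(z), each block of Gamma
    functions occurring in the gauge factors turns one linear factor of alpha
    or beta into the one with the opposite parameter, up to a sign:
    - the block Gamma(1/2+r+x) Gamma(1/2+r-x) is invariant under R, while its
      quotient under TR replaces x - r + 1/2 by -(x + r + 1/2) in beta;
    - the block 1 / (Gamma(rho-x) Gamma(1+rho+x)) is invariant under TR, while
      its quotient under R replaces x - rho by -(x + rho) in alpha.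
    So a gauge factor amounts to a choice of the parameters whose sign is
    flipped, and, with alpha', beta' the coefficients for the flipped
    parameters s', conjugation by it turns alpha R + beta TR into
    e1 alpha' R + e2 beta' TR with e1 = (-1)^(number of flipped rho's) and
    e2 = (-1)^(number of flipped r's).  If e1 = e2 = e the conjugate of H is e
    times the operator H' of s', plus e (alpha' + beta') - (alpha + beta)
    ([BI_op_flip]).  That function is constant ([BI_coef_flip]): the residues of
    alpha and beta are proportional to rho1 rho2 and r1 r2, which are
    themselves multiplied by e.  Exactly eight of the sixteen choices satisfy
    e1 = e2, and these are the eight gauge factors; e = -1 for d >= 5.

    The analytic input is that Gauss's product converges for every complex z,
    to a nonzero number away from the poles ([Gamma_seq_cvg_neq0]).  The ratio
    of two consecutive terms is 1 + O(1/n - 1/(n+1)) ([Gamma_ratio_le]), and a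
    sequence with such ratios converges to a nonzero limit ([ratio_cvg_neq0]).
    The functional equation follows by comparing the products for z and z + 1.
    As 1 / Gamma vanishes at the poles, 1/Gamma(z) = z / Gamma(z+1) holds
    everywhere ([invGammaD1]), so the blocks in the denominator do not
    restrict the domain.  Finally, on the imaginary axis minus the origin no
    Gamma factor has a pole, hence the gauge factor does not vanish there, and
    neither does the polynomial at all but finitely many points: the
    eigenfunction is not identically zero. *)

(** * Bounds for sine, cosine, exponential and logarithm *)

Section RealEstimates.
Variable R : realType.
Implicit Types x a : R.
Local Open Scope ring_scope.
Local Open Scope classical_set_scope.

(** One mean value argument serves both |sin x| <= |x| and the cubic bound on
    sin x - x. *)
Lemma sin_mean_value x : exists2 c, `|c| <= `|x| & sin x = cos c * x.
Proof.
wlog x0 : x / 0 <= x.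
  move=> pos; have [/pos//|xn] := leP 0 x.
  have [|c cx sx] := pos (- x); first by lra.
  exists c; first by rewrite normrN in cx.
  by rewrite sinN in sx; rewrite -[LHS]opprK sx mulrN opprK.
have [|c] := @MVT_segment R sin cos 0 x x0 (fun y _ => is_derive_sin y).
  by apply: continuous_subspaceT; exact: continuous_sin.
rewrite in_itv /= sin0 !subr0 => /andP[c0 cx] ->; exists c => //.
by rewrite !ger0_norm.
Qed.

Lemma sin_norm_le x : `|sin x| <= `|x|.
Proof.
have [c _ ->] := sin_mean_value x.
by rewrite normrM ler_piMl ?cos_max.
Qed.

Lemma cos_quadratic_le x : 1 - cos x <= x ^+ 2 / 2.
Proof.
have xE : x = (x / 2) *+ 2 by rewrite -[RHS]mulr_natr divfK ?pnatr_eq0.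
have := sin_norm_le (x / 2); rewrite -ler_sqr ?nnegrE// !real_normK ?num_real//.
by rewrite [in cos x]xE cos_mulr2n cos2sin2 => ?; lra.
Qed.

Lemma sin_cubic_le x : `|sin x - x| <= x ^+ 2 / 2 * `|x|.
Proof.
have [c cx ->] := sin_mean_value x.
rewrite -{2}[x]mul1r -mulrBl normrM ler_wpM2r// distrC ger0_norm; last first.
  by rewrite subr_ge0 cos_le1.
apply: le_trans (cos_quadratic_le _) _; rewrite ler_pM2r ?invr_gt0//.
by rewrite -[leLHS]real_normK ?num_real// -[leRHS]real_normK ?num_real// ler_sqr.
Qed.

Lemma expR_le_inv a : a < 1 -> expR a <= (1 - a)^-1.
Proof.
move=> a1; rewrite -[a in expR a]opprK expRN lef_pV2 ?posrE ?expR_gt0 ?subr_gt0//.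
exact: expR_ge1Dx.
Qed.

Lemma expR_quadratic_le a : `|a| <= 1 / 2 -> `|expR a - 1 - a| <= 2 * a ^+ 2.
Proof.
rewrite ler_norml => /andP[al au]; have a1 : a < 1 by lra.
rewrite ger0_norm; last by have := expR_ge1Dx a; lra.
have := expR_le_inv a1; set e := expR a => ea.
have {}ea : e * (1 - a) <= 1 by rewrite -ler_pdivlMr ?div1r ?subr_gt0.
have e0 : 0 < e by exact: expR_gt0.
suff : (e - 1 - a) * (1 - a) <= 2 * a ^+ 2 * (1 - a).
  by rewrite ler_pM2r ?subr_gt0.
have : 0 <= a ^+ 2 * (1 / 2 - a) by rewrite mulr_ge0 ?sqr_ge0 ?subr_ge0.
by rewrite expr2; lra.
Qed.

Lemma expR_le2 a : `|a| <= 1 / 2 -> expR a <= 2.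
Proof.
rewrite ler_norml => /andP[al au]; apply: le_trans (expR_le_inv _) _; first by lra.
by rewrite invf_ple ?posrE; lra.
Qed.

Lemma ln_succ_bounds n : (0 < n)%N ->
  n.+1%:R^-1 <= (ln n.+1%:R - ln n%:R : R) <= n%:R^-1.
Proof.
move=> n0; have nR : 0 < n%:R :> R by rewrite ltr0n.
have nR1 : 0 < n.+1%:R :> R by rewrite ltr0n.
have nE : n.+1%:R = n%:R + 1 :> R by rewrite -natr1.
apply/andP; split.
- rewrite -lerN2 opprB -ln_div ?posrE//.
  have -> : n%:R / n.+1%:R = 1 + - n.+1%:R^-1 :> R.
    by rewrite nE; field; rewrite -nE gt_eqF.
  by apply: le_ln1Dx; rewrite ltrN2 invf_lt1// ltr1n.
- rewrite -ln_div ?posrE//.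
  have -> : n.+1%:R / n%:R = 1 + n%:R^-1 :> R.
    by rewrite nE; field; rewrite gt_eqF.
  by apply: le_ln1Dx; rewrite (@lt_trans _ _ 0)// invr_gt0.
Qed.

End RealEstimates.

(** * Complex sequences given by their consecutive ratios *)

Section ComplexSequences.
Variable R : realType.
Implicit Types (u v : nat -> R[i]) (z w : R[i]).
Local Open Scope ring_scope.
Local Open Scope complex_scope.
Local Open Scope classical_set_scope.

Local Notation cnorm := (@ComplexField.Normc.normc R).

Lemma cnormE z : (cnorm z)%:C = `|z|.
Proof. by []. Qed.

Lemma cnorm_ge0 z : 0 <= cnorm z.
Proof. by rewrite -ler0c cnormE. Qed.

Lemma cnorm_triangle z w : cnorm (z + w) <= cnorm z + cnorm w.
Proof. by rewrite -lecR rmorphD; exact: (@ler_normD _ R[i]). Qed.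

Lemma cnormM z w : cnorm (z * w) = cnorm z * cnorm w.
Proof. exact: ComplexField.Normc.normcM. Qed.

Lemma cnormV z : cnorm z^-1 = (cnorm z)^-1.
Proof. exact: ComplexField.Normc.normcV. Qed.

Lemma cnormR (a : R) : cnorm a%:C = `|a|.
Proof. by rewrite /= expr0n addr0 sqrtr_sqr. Qed.

Lemma cnorm_sqr z : cnorm z ^+ 2 = complex.Re z ^+ 2 + complex.Im z ^+ 2.
Proof. by case: z => a b /=; rewrite sqr_sqrtr ?addr_ge0 ?sqr_ge0. Qed.

Lemma cnorm_gt0 z : z != 0 -> 0 < cnorm z.
Proof. by rewrite -ltcR cnormE normr_gt0. Qed.

Lemma cnormN z : cnorm (- z) = cnorm z.
Proof. by apply: complexI; rewrite !cnormE normrN. Qed.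

Lemma cnormB z w : cnorm (z - w) = cnorm (w - z).
Proof. by rewrite -cnormN opprB. Qed.

Lemma Re_le_cnorm z : `|complex.Re z| <= cnorm z.
Proof.
rewrite -ler_sqr ?nnegrE ?cnorm_ge0// cnorm_sqr real_normK ?num_real//.
by rewrite lerDl sqr_ge0.
Qed.

Lemma Im_le_cnorm z : `|complex.Im z| <= cnorm z.
Proof.
rewrite -ler_sqr ?nnegrE ?cnorm_ge0// cnorm_sqr real_normK ?num_real//.
by rewrite lerDr sqr_ge0.
Qed.

Lemma cnorm_le_ReIm z : cnorm z <= `|complex.Re z| + `|complex.Im z|.
Proof.
rewrite -ler_sqr ?nnegrE ?cnorm_ge0 ?addr_ge0// cnorm_sqr sqrrD.
rewrite !real_normK ?num_real// lerD2r lerDl.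
by rewrite mulrn_wge0// mulr_ge0.
Qed.

(** Componentwise convergence, the form in which Gamma is defined as a limit. *)
Definition ccvg u z :=
  (complex.Re (u n) @[n --> \oo] --> complex.Re z) /\
  (complex.Im (u n) @[n --> \oo] --> complex.Im z).

Lemma ccvg_unique u z w : ccvg u z -> ccvg u w -> z = w.
Proof.
case: z w => [a b] [c d] [/= ua ub] [/= uc ud].
by congr (_ +i* _); [apply: cvg_unique ua uc|apply: cvg_unique ub ud].
Qed.

Lemma ccvg_eventually_eq N u v z : (forall n, (N <= n)%N -> u n = v n) ->
  ccvg u z -> ccvg v z.
Proof.
move=> uv [uz1 uz2]; split.
- apply: cvg_trans uz1; apply: near_eq_cvg; exists N => // n /= Nn.
  by rewrite uv.
- apply: cvg_trans uz2; apply: near_eq_cvg; exists N => // n /= Nn.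
  by rewrite uv.
Qed.

Lemma ccvg_cst z : ccvg (fun=> z) z.
Proof. by split; exact: cvg_cst. Qed.

Lemma ReD z w : complex.Re (z + w) = complex.Re z + complex.Re w.
Proof. by case: z w => [? ?] []. Qed.

Lemma ImD z w : complex.Im (z + w) = complex.Im z + complex.Im w.
Proof. by case: z w => [? ?] []. Qed.

Lemma ccvgD u v z w : ccvg u z -> ccvg v w -> ccvg (fun n => u n + v n) (z + w).
Proof.
move=> [u1 u2] [v1 v2]; split.
- by rewrite ReD; under eq_fun do rewrite ReD; exact: cvgD.
- by rewrite ImD; under eq_fun do rewrite ImD; exact: cvgD.
Qed.

Lemma ReM z w : complex.Re (z * w) =
  complex.Re z * complex.Re w - complex.Im z * complex.Im w.
Proof. by case: z w => [? ?] []. Qed.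

Lemma ImM z w : complex.Im (z * w) =
  complex.Re z * complex.Im w + complex.Im z * complex.Re w.
Proof. by case: z w => [? ?] []. Qed.

Lemma ccvgM u v z w : ccvg u z -> ccvg v w -> ccvg (fun n => u n * v n) (z * w).
Proof.
move=> [u1 u2] [v1 v2]; split.
- by rewrite ReM; under eq_fun do rewrite ReM; apply: cvgB; exact: cvgM.
- by rewrite ImM; under eq_fun do rewrite ImM; apply: cvgD; exact: cvgM.
Qed.

Lemma ccvg_invn : ccvg (fun n => (n%:R^-1)%:C) 0.
Proof.
split => /=; last exact: cvg_cst.
rewrite -(cvg_shiftn 1) /=; under eq_fun do rewrite addn1.
exact: cvg_harmonic.
Qed.

(** For n > 0 this is 1 / (n (n + 1)); written so, its sums telescope. *)
Definition gap (n : nat) : R := n%:R^-1 - n.+1%:R^-1.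

Lemma gap_ge0 n : (0 < n)%N -> 0 <= gap n.
Proof. by move=> n0; rewrite subr_ge0 lef_pV2 ?posrE ?ltr0n// ler_nat. Qed.

(** As [gap] telescopes, w n - K/n is nondecreasing from N on, and it is bounded
    above by M. *)
Lemma real_cvg_of_gap (w : nat -> R) (K M : R) N :
  (forall n, (N <= n)%N -> `|w n| <= M) ->
  (forall n, (N <= n)%N -> `|w n.+1 - w n| <= K * gap n) ->
  0 <= K ->
  cvgn w.
Proof.
move=> wM wK K0; pose v n := w n - K * n%:R^-1.
suff cv : cvgn v.
  have -> : w = v \+ (fun n => K * n%:R^-1).
    by apply/funext => n; rewrite /v /= subrK.
  apply: is_cvgD => //; apply: is_cvgMr.
  by apply/cvg_ex; exists 0; case: ccvg_invn.
apply: (@near_nondecreasing_is_cvgn _ _ M).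
- exists N => // a /= Na b ab.
  have vS i : (N <= i)%N -> v i <= v i.+1.
    move=> Ni; have := wK i Ni; rewrite /v /gap ler_norml => /andP[+ _].
    rewrite mulrBr; move: (K * i%:R^-1) (K * i.+1%:R^-1) => a0 b0 ?; lra.
  elim: b ab => [|b IH]; first by rewrite leqn0 => /eqP ->.
  rewrite leq_eqVlt => /predU1P[->//|/[!ltnS] ab].
  exact: le_trans (IH ab) (vS _ (leq_trans Na ab)).
- exists N => // n /= Nn; rewrite /v.
  have := wM n Nn; rewrite ler_norml => /andP[_ ?].
  have ? : 0 <= K * n%:R^-1 by rewrite mulr_ge0 ?invr_ge0.
  lra.
Qed.

(** Since 1 + c gap n <= exp (c/n - c/(n+1)), the sequence
    |u n| exp (c/n) is nonincreasing from N on; hence u is bounded, and its increments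
    are bounded by a multiple of [gap]. *)
Lemma ratio_cvg u (c : R) N : 0 <= c ->
  (forall n, (N <= n)%N -> cnorm (u n.+1 - u n) <= c * gap n * cnorm (u n)) ->
  exists z, ccvg u z.
Proof.
move=> c0 uc.
pose e n := cnorm (u n) * expR (c / n%:R).
have eS n : (N <= n)%N -> e n.+1 <= e n.
  move=> Nn; have le1 : cnorm (u n.+1) <= (1 + c * gap n) * cnorm (u n).
    have := cnorm_triangle (u n.+1 - u n) (u n); rewrite subrK.
    by have := uc n Nn => ? ?; lra.
  have -> : e n = cnorm (u n) * (expR (c * gap n) * expR (c / n.+1%:R)).
    by rewrite -expRD /gap mulrBr subrK.
  rewrite mulrA ler_wpM2r ?expR_ge0//; apply: le_trans le1 _.
  by rewrite mulrC ler_wpM2l ?cnorm_ge0 ?expR_ge1Dx.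
have eN n : (N <= n)%N -> e n <= e N.
  elim: n => [|n IH]; first by rewrite leqn0 => /eqP ->.
  rewrite leq_eqVlt => /predU1P[->//|/[!ltnS] Nn].
  exact: le_trans (eS _ Nn) (IH Nn).
have uM n : (N <= n)%N -> cnorm (u n) <= e N.
  move=> Nn; apply: le_trans (eN n Nn).
  rewrite ler_peMr ?cnorm_ge0// (le_trans _ (expR_ge1Dx _))// lerDl.
  by rewrite mulr_ge0 ?invr_ge0.
have e0 : 0 <= e N by rewrite mulr_ge0 ?cnorm_ge0 ?expR_ge0.
have uK n : (maxn N 1 <= n)%N -> cnorm (u n.+1 - u n) <= c * e N * gap n.
  rewrite geq_max => /andP[Nn n0]; apply: le_trans (uc n Nn) _.
  rewrite [leRHS]mulrAC ler_wpM2l ?uM//.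
  by rewrite mulr_ge0 ?gap_ge0.
have K0 : 0 <= c * e N by rewrite mulr_ge0.
have /cvg_ex[/= a ua] : cvgn (fun n => complex.Re (u n)).
  apply: (@real_cvg_of_gap _ _ (e N) (maxn N 1) _ _ K0) => n Nn.
  - apply: le_trans (Re_le_cnorm _) (uM _ _).
    by apply: leq_trans Nn; exact: leq_maxl.
  - apply: le_trans (uK _ Nn); apply: le_trans (Re_le_cnorm _).
    by case: (u n.+1) (u n) => [? ?] [].
have /cvg_ex[/= b ub] : cvgn (fun n => complex.Im (u n)).
  apply: (@real_cvg_of_gap _ _ (e N) (maxn N 1) _ _ K0) => n Nn.
  - apply: le_trans (Im_le_cnorm _) (uM _ _).
    by apply: leq_trans Nn; exact: leq_maxl.
  - apply: le_trans (uK _ Nn); apply: le_trans (Im_le_cnorm _).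
    by case: (u n.+1) (u n) => [? ?] [].
by exists (a +i* b).
Qed.

(** The reciprocals satisfy a bound of the same kind, with 2c instead of c, so
    they converge too, and the product of the two limits is 1. *)
Lemma ratio_cvg_neq0 u (c : R) N : 0 <= c ->
  (forall n, (N <= n)%N -> u n != 0) ->
  (forall n, (N <= n)%N -> cnorm (u n.+1 - u n) <= c * gap n * cnorm (u n)) ->
  exists2 z, ccvg u z & z != 0.
Proof.
move=> c0 u0 uc; have [z uz] := ratio_cvg c0 uc; exists z => //.
pose N' := maxn (maxn N 1) (Num.bound (2 * c)).
have inv_uc n : (N' <= n)%N ->
    cnorm ((u n.+1)^-1 - (u n)^-1) <= 2 * c * gap n * cnorm (u n)^-1.
  rewrite !geq_max => /andP[/andP[Nn n0] cn].
  have un := u0 n Nn; have un1 := u0 n.+1 (leqW Nn).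
  have nun := cnorm_gt0 un; have nun1 := cnorm_gt0 un1.
  (* from here the ratio u n.+1 / u n has modulus at least 1/2 *)
  have cg : c * gap n <= 1 / 2.
    have nR : 0 < n%:R :> R by rewrite ltr0n.
    have cn' : 2 * c <= n%:R.
      rewrite (@le_trans _ _ (Num.bound (2 * c))%:R) ?ler_nat//.
      by rewrite ltW// archi_boundP// mulr_ge0.
    apply: (@le_trans _ _ (c * n%:R^-1)); last by rewrite ler_pdivrMr//; lra.
    by rewrite ler_wpM2l// /gap lerBlDr lerDl invr_ge0.
  have half : cnorm (u n) <= 2 * cnorm (u n.+1).
    have := cnorm_triangle (u n - u n.+1) (u n.+1); rewrite subrK.
    rewrite cnormB; have := uc n Nn; have : c * gap n * cnorm (u n) <= 1 / 2 * cnorm (u n).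
      by rewrite ler_wpM2r ?cnorm_ge0.
    by move=> ? ? ?; lra.
  have -> : (u n.+1)^-1 - (u n)^-1 = (u n - u n.+1) * (u n)^-1 * (u n.+1)^-1.
    by field; rewrite un un1.
  rewrite !cnormM !cnormV cnormB ler_pdivrMr// mulrAC ler_wpM2r ?invr_ge0 ?cnorm_ge0//.
  apply: le_trans (uc n Nn) _.
  have : c * gap n * cnorm (u n) <= c * gap n * (2 * cnorm (u n.+1)).
    by rewrite ler_wpM2l// mulr_ge0 ?gap_ge0.
  by move=> ?; lra.
have [|z' uz'] := ratio_cvg _ inv_uc; first by rewrite mulr_ge0.
apply/eqP => z0; have : (1 : R[i]) = z * z'.
  apply: ccvg_unique (ccvgM uz uz').
  apply: (@ccvg_eventually_eq N _ _ _ _ (ccvg_cst 1)) => n Nn.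
  by rewrite divff// u0.
by rewrite z0 mul0r => /eqP; rewrite oner_eq0.
Qed.

End ComplexSequences.

(** * The complex exponential and the ratios in Gauss's product *)

Section ComplexGamma.
Variable R : realType.
Implicit Types (z w : R[i]).
Local Open Scope ring_scope.
Local Open Scope complex_scope.
Local Open Scope classical_set_scope.

Local Notation cnorm := (@ComplexField.Normc.normc R).

Lemma cexpD z w : cexp (z + w) = cexp z * cexp w.
Proof.
case: z w => [a b] [c d]; rewrite /cexp /= expRD cosD sinD.
by apply/eqP; rewrite eq_complex /=; apply/andP; split; apply/eqP; ring.
Qed.

Lemma cexp_real (a : R) : cexp a%:C = (expR a)%:C.
Proof. by rewrite /cexp /= cos0 sin0 mulr1 mulr0. Qed.

Lemma cexp_neq0 z : cexp z != 0.
Proof.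
apply/eqP => z0; have : cexp z * cexp (- z) = 1.
  by rewrite -cexpD subrr -[0]/(0%:C) cexp_real expR0.
by rewrite z0 mul0r => /esym/eqP; rewrite oner_eq0.
Qed.

(** The real and imaginary parts are expanded around exp a - 1 - a, 1 - cos b
    and sin b - b, each of second order. *)
Lemma cexp_quadratic_le w : cnorm w <= 1 / 2 ->
  cnorm (cexp w - 1 - w) <= 4 * cnorm w ^+ 2.
Proof.
move=> w2; have a2 := le_trans (Re_le_cnorm w) w2.
have b2 := le_trans (Im_le_cnorm w) w2.
rewrite cnorm_sqr; apply: le_trans (cnorm_le_ReIm _) _.
case: w a2 b2 {w2} => a b /= a2 b2.
have -> : expR a * cos b - 1 - a =
          (expR a - 1 - a) - expR a * (1 - cos b) by ring.
have -> : expR a * sin b - 0 - b =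
          expR a * (sin b - b) + (expR a - 1 - a) * b + a * b by ring.
have e0 := expR_gt0 a; have e2 := expR_le2 a2.
have ea := expR_quadratic_le a2.
have b20 := sqr_ge0 b; have a20 := sqr_ge0 a.
have re : `|expR a - 1 - a - expR a * (1 - cos b)| <= 2 * a ^+ 2 + b ^+ 2.
  apply: le_trans (ler_normB _ _) _; apply: lerD => //.
  rewrite normrM gtr0_norm// ger0_norm ?subr_ge0 ?cos_le1//.
  have -> : b ^+ 2 = 2 * (b ^+ 2 / 2) by field.
  by rewrite ler_pM ?subr_ge0 ?cos_le1 ?cos_quadratic_le// ltW.
have im1 : `|expR a * (sin b - b)| <= b ^+ 2 / 2.
  rewrite normrM gtr0_norm//.
  have -> : b ^+ 2 / 2 = 2 * (b ^+ 2 / 2 * (1 / 2)) by field.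
  rewrite ler_pM ?(ltW e0)//; apply: le_trans (sin_cubic_le b) _.
  by rewrite ler_wpM2l// divr_ge0.
have im2 : `|(expR a - 1 - a) * b| <= a ^+ 2.
  rewrite normrM; have -> : a ^+ 2 = (2 * a ^+ 2) * (1 / 2) by field.
  by rewrite ler_pM.
have im3 : `|a * b| <= (a ^+ 2 + b ^+ 2) / 2.
  rewrite normrM -[a ^+ 2]real_normK ?num_real// -[b ^+ 2]real_normK ?num_real//.
  by have := sqr_ge0 (`|a| - `|b|); rewrite sqrrB => ?; lra.
have := ler_normD (expR a * (sin b - b) + (expR a - 1 - a) * b) (a * b).
have := ler_normD (expR a * (sin b - b)) ((expR a - 1 - a) * b).
by move=> ? ?; lra.
Qed.

Definition Gamma_ratio z (n : nat) : R[i] :=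
  n.+1%:R * cexp (z * (ln n.+1%:R - ln n%:R)%:C) / (z + n.+1%:R).

Lemma Gamma_seqS z n : (Gamma_seq z n.+1) = Gamma_ratio z n * Gamma_seq z n.
Proof.
rewrite /Gamma_seq /Gamma_ratio big_ord_recr /= factS natrM invfM.
have -> : z * (ln n.+1%:R)%:C =
    z * (ln n.+1%:R - ln n%:R)%:C + z * (ln n%:R)%:C.
  by rewrite -mulrDr -rmorphD /= subrK.
rewrite cexpD; move: (cexp _) (cexp _) => x y.
by move: (_^-1) (_^-1) => s t; ring.
Qed.

Lemma not_pole_neq0 z n : ~ Gamma_pole z -> z + n%:R != 0.
Proof. by move=> zp; apply/eqP => /addr0_eq z0; apply: zp; exists n; rewrite -z0 opprK. Qed.

Lemma Gamma_seq_neq0 z n : ~ Gamma_pole z -> Gamma_seq z n != 0.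
Proof.
move=> zp; rewrite /Gamma_seq; apply: mulf_neq0.
  by rewrite mulf_neq0 ?cexp_neq0// pnatr_eq0 -lt0n fact_gt0.
by rewrite invr_eq0; apply/prodf_neq0 => k _; exact: not_pole_neq0.
Qed.

Lemma cnorm_nat n : cnorm n%:R = n%:R.
Proof. by rewrite -[n%:R in LHS](rmorph_nat (real_complex R)) cnormR ger0_norm. Qed.

(** With h = ln (1 + 1/n), w = z h and q the ratio,
      (q - 1) (z + n + 1) = (n + 1) (exp w - 1 - w) + z ((n + 1) h - 1),
    where both terms are O(1/n) because 1/(n+1) <= h <= 1/n, and
    |z + n + 1| >= (n + 1) / 2 as soon as 2 |z| <= n. *)
Lemma Gamma_ratio_le z (A : R := cnorm z) n : (0 < n)%N -> 2 * A <= n%:R ->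
  cnorm (Gamma_ratio z n - 1) <= 2 * (8 * A ^+ 2 + A) * gap R n.
Proof.
move=> n0 An.
have A0 : 0 <= A by exact: cnorm_ge0.
have /andP[lh hl] := ln_succ_bounds R n0.
set h : R := ln n.+1%:R - ln n%:R in lh hl.
have h0 : 0 <= h by apply: le_trans lh; rewrite invr_ge0.
have nR : 1 <= n%:R :> R by rewrite ler1n.
have nE : n.+1%:R = n%:R + 1 :> R by rewrite -natr1.
set w := z * h%:C.
have wE : cnorm w = A * h by rewrite cnormM cnormR ger0_norm.
set m : R := n%:R in nR nE An hl *.
have hm : h * m <= 1 by rewrite -ler_pdivlMr ?div1r; lra.
have mh : 1 <= h * (m + 1).
  by rewrite -nE -ler_pdivrMr ?div1r// nE; lra.
have w2 : cnorm w <= 1 / 2.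
  rewrite wE; have : A * h <= m / 2 * h by rewrite ler_wpM2r//; lra.
  by move=> ?; lra.
have denge : (m + 1) / 2 <= cnorm (z + n.+1%:R).
  have := cnorm_triangle (z + n.+1%:R) (- z); rewrite addrAC subrr add0r.
  rewrite cnorm_nat nE.
  by rewrite cnormN -/A => ?; lra.
have den0 : 0 < cnorm (z + n.+1%:R) by apply: lt_le_trans denge; lra.
have dn0 : z + n.+1%:R != 0.
  by apply/eqP => d0; move: den0; rewrite d0 ComplexField.Normc.normc0 ltxx.
have -> : Gamma_ratio z n - 1 =
    (n.+1%:R * (cexp w - 1 - w) + z * (h * (m + 1) - 1)%:C) / (z + n.+1%:R).
  rewrite /Gamma_ratio -/h -/w.
  have -> : (h * (m + 1) - 1)%:C = h%:C * n.+1%:R - 1.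
    by rewrite -nE rmorphB rmorphM rmorph_nat.
  by rewrite /w; move: (cexp _) => e; field; rewrite nat1r.
rewrite cnormM cnormV ler_pdivrMr//.
have num : cnorm (n.+1%:R * (cexp w - 1 - w) + z * (h * (m + 1) - 1)%:C) <=
    (m + 1) * (4 * (A * h) ^+ 2) + A * (h * (m + 1) - 1).
  apply: le_trans (cnorm_triangle _ _) _.
  rewrite !cnormM cnorm_nat cnormR ger0_norm ?subr_ge0// nE lerD2r.
  rewrite ler_wpM2l; [|lra|by rewrite -wE cexp_quadratic_le].
  by [].
apply: le_trans num _.
have gE : gap R n * ((m + 1) * m) = 1.
  by rewrite /gap -/m nE; field; apply/andP; split; apply: lt0r_neq0; lra.
have g0 : 0 <= gap R n := gap_ge0 R n0.
apply: (@le_trans _ _ (2 * (8 * A ^+ 2 + A) * gap R n * ((m + 1) / 2))); last first.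
  by rewrite ler_wpM2l// !mulr_ge0// addr_ge0// mulr_ge0// sqr_ge0.
rewrite -(@ler_pM2r _ m); last lra.
have -> : 2 * (8 * A ^+ 2 + A) * gap R n * ((m + 1) / 2) * m = 8 * A ^+ 2 + A.
  by transitivity ((8 * A ^+ 2 + A) * (gap R n * ((m + 1) * m))); [field|rewrite gE mulr1].
have t1 : (m + 1) * (4 * (A * h) ^+ 2) * m <= 8 * A ^+ 2.
  have -> : (m + 1) * (4 * (A * h) ^+ 2) * m = 4 * A ^+ 2 * ((h * m) * (h * (m + 1))) by ring.
  have -> : 8 * A ^+ 2 = 4 * A ^+ 2 * (1 * 2) by ring.
  rewrite ler_wpM2l ?mulr_ge0 ?sqr_ge0//.
  have hhm : h <= h * m by rewrite ler_peMr.
  by apply: ler_pM => //; [rewrite mulr_ge0//; lra|lra|lra].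
have t2 : A * (h * (m + 1) - 1) * m <= A.
  have : h * (m + 1) * m <= m + 1.
    by rewrite mulrAC -[leRHS]mul1r ler_wpM2r//; lra.
  move=> hmm; rewrite -mulrA -[leRHS]mulr1 ler_wpM2l//; lra.
by lra.
Qed.

End ComplexGamma.

(** * The Gamma function and its functional equation *)

Section GammaFunction.
Variable R : realType.
Implicit Types (z w : R[i]).
Local Open Scope ring_scope.
Local Open Scope complex_scope.
Local Open Scope classical_set_scope.

Lemma ccvg_Gamma z l : ccvg (Gamma_seq z) l -> Gamma z = l.
Proof.
case: l => a b [/= ca cb]; rewrite /Gamma.
by rewrite (cvg_lim (@Rhausdorff R) ca) (cvg_lim (@Rhausdorff R) cb).
Qed.

Lemma Gamma_seq_cvg_neq0 z : ~ Gamma_pole z ->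
  ccvg (Gamma_seq z) (Gamma z) /\ Gamma z != 0.
Proof.
move=> zp; set A : R := ComplexField.Normc.normc z.
have A0 : 0 <= A := cnorm_ge0 z.
suff [l gl l0] : exists2 l, ccvg (Gamma_seq z) l & l != 0.
  by rewrite (ccvg_Gamma gl).
apply: (@ratio_cvg_neq0 _ _ (2 * (8 * A ^+ 2 + A)) (maxn 1 (Num.bound (2 * A)))).
- by rewrite mulr_ge0// addr_ge0// mulr_ge0// sqr_ge0.
- by move=> n _; exact: Gamma_seq_neq0.
- move=> n; rewrite geq_max => /andP[n0 nb].
  rewrite Gamma_seqS -[X in _ - X]mul1r -mulrBl cnormM ler_wpM2r ?cnorm_ge0//.
  apply: Gamma_ratio_le => //.
  apply: (@le_trans _ _ (Num.bound (2 * A))%:R); last by rewrite ler_nat.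
  by rewrite ltW// archi_boundP// mulr_ge0.
Qed.

Lemma Gamma_neq0 z : ~ Gamma_pole z -> Gamma z != 0.
Proof. by case/Gamma_seq_cvg_neq0. Qed.

(** Beyond the index of the pole the terms are divisions by zero. *)
Lemma Gamma_at_pole z : Gamma_pole z -> Gamma z = 0.
Proof.
move=> [k zk]; apply: ccvg_Gamma.
apply: (@ccvg_eventually_eq _ k _ _ _ _ (ccvg_cst 0)) => n kn.
have kn' : (k < n.+1)%N by rewrite ltnS.
by rewrite /Gamma_seq (bigD1 (Ordinal kn')) //= zk addNr mul0r invr0 mulr0.
Qed.

Lemma Gamma_poleD1 z : Gamma_pole (z + 1) -> Gamma_pole z.
Proof.
by move=> [k zk]; exists k.+1; rewrite -[z](addrK 1) zk -natr1 opprD.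
Qed.

(** The correction factor is (z + n + 1) / n, left by the shift of the product;
    it tends to 1. *)
Lemma Gamma_seqD1 z n : ~ Gamma_pole z -> (0 < n)%N ->
  Gamma_seq (z + 1) n * (1 + (z + 1) * (n%:R^-1)%:C) = z * Gamma_seq z n.
Proof.
move=> zp n0; rewrite /Gamma_seq.
have nR : n%:R != 0 :> R[i] by rewrite pnatr_eq0 -lt0n.
have z0 : z != 0 by have := not_pole_neq0 0 zp; rewrite addr0.
have zn0 := not_pole_neq0 n.+1 zp.
have zn0' : z + 1 + n%:R != 0 by rewrite -addrA nat1r.
have pE : (\prod_(k < n.+1) (z + k%:R)) * (z + n.+1%:R) =
    z * \prod_(k < n.+1) (z + 1 + k%:R).
  transitivity (\prod_(k < n.+2) (z + k%:R)); first by rewrite [RHS]big_ord_recr.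
  rewrite big_ord_recl addr0.
  congr (_ * _); apply: eq_bigr => i _.
  by rewrite lift0 -addrA nat1r.
have cE : cexp ((z + 1) * (ln n%:R)%:C) = cexp (z * (ln n%:R)%:C) * n%:R.
  rewrite mulrDl cexpD mul1r cexp_real lnK ?posrE ?ltr0n//.
  by rewrite rmorph_nat.
rewrite cE rmorphV ?unitfE ?pnatr_eq0 -?lt0n//= rmorph_nat.
have p0 : \prod_(k < n.+1) (z + k%:R) != 0.
  by apply/prodf_neq0 => k _; exact: not_pole_neq0.
have -> : \prod_(k < n.+1) (z + 1 + k%:R) =
   (\prod_(k < n.+1) (z + k%:R)) * (z + 1 + n%:R) / z.
  by rewrite -[z + 1 + _]addrA nat1r pE mulrAC divff// mul1r.
move: (\prod_(k < n.+1) _) (cexp _) p0 (n`!%:R) => p e p0 f.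
by field; rewrite p0 z0 zn0' nR.
Qed.

Lemma GammaD1 z : ~ Gamma_pole z -> Gamma (z + 1) = z * Gamma z.
Proof.
move=> zp; have zp1 : ~ Gamma_pole (z + 1) by move/Gamma_poleD1.
have [g1 _] := Gamma_seq_cvg_neq0 zp1; have [g _] := Gamma_seq_cvg_neq0 zp.
have c := ccvgM g1 (ccvgD (ccvg_cst 1) (ccvgM (ccvg_cst (z + 1)) (ccvg_invn R))).
rewrite mulr0 addr0 mulr1 in c.
apply: ccvg_unique c _.
apply: (@ccvg_eventually_eq _ 1 _ _ _ _ (ccvgM (ccvg_cst z) g)) => n n0.
by rewrite Gamma_seqD1.
Qed.

(** At a pole both sides vanish: either z = 0, or z + 1 is a pole too. *)
Lemma invGammaD1 z : (Gamma z)^-1 = z * (Gamma (z + 1))^-1.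
Proof.
have [zp|zp] := pselect (Gamma_pole z); last first.
  have z0 : z != 0 by have := not_pole_neq0 0 zp; rewrite addr0.
  by rewrite GammaD1// invfM mulVKf.
rewrite (Gamma_at_pole zp) invr0; case: zp => -[|k] ->.
  by rewrite oppr0 mul0r.
rewrite (@Gamma_at_pole (_ + 1)) ?invr0 ?mulr0//.
by exists k; rewrite -natr1 opprD subrK.
Qed.

End GammaFunction.

(** * Conjugating the Bannai-Ito operator by a gauge factor *)

Section GaugeFactors.
Variable R : realType.
Implicit Types (s : params R) (x : R[i]) (b : bool) (r rho : R).
Local Open Scope ring_scope.
Local Open Scope complex_scope.

Lemma realcD (a b : R) : (a + b)%:C = a%:C + b%:C.
Proof. exact: rmorphD. Qed.

Lemma realcN (a : R) : (- a)%:C = - a%:C.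
Proof. exact: rmorphN. Qed.

Lemma realcM (a b : R) : (a * b)%:C = a%:C * b%:C.
Proof. exact: rmorphM. Qed.

Lemma realc1 : (1 : R)%:C = 1.
Proof. exact: rmorph1. Qed.

Lemma realc_nat n : (n%:R : R)%:C = n%:R.
Proof. exact: rmorph_nat. Qed.

Lemma realc_half : (2^-1 : R)%:C = 2^-1.
Proof. by rewrite fmorphV rmorph_nat. Qed.

Lemma realc_sign b : ((-1) ^+ b : R)%:C = (-1) ^+ b.
Proof. exact: rmorph_sign. Qed.

Lemma gauge_num_opp r x : gauge_num r (- x) = gauge_num r x.
Proof. by rewrite /gauge_num opprK mulrC. Qed.

(** Both sides equal (x - r + 1/2) (x + r + 1/2) times the product of the Gamma
    values at 1/2 + r + x and -1/2 + r - x, neither of which is a pole. *)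
Lemma gauge_num_shift r x :
  gauge_num_defined r x -> gauge_num_defined r (- x - 1) ->
  (x - r%:C + 1 / 2) * gauge_num r (- x - 1) =
  - (x + r%:C + 1 / 2) * gauge_num r x.
Proof.
move=> [xp _] [xm _]; rewrite /gauge_num.
have -> : 1 / 2 + r%:C - (- x - 1) = 1 / 2 + r%:C + x + 1 by ring.
have -> : 1 / 2 + r%:C - x = 1 / 2 + r%:C + (- x - 1) + 1 by ring.
by rewrite !GammaD1//; field.
Qed.

Lemma inv_gauge_den_shift rho x :
  (gauge_den rho (- x - 1))^-1 = (gauge_den rho x)^-1.
Proof.
rewrite /gauge_den mulrC; congr (_ * _)^-1; congr Gamma; ring.
Qed.

(** True without restriction on x, by [invGammaD1]. *)
Lemma inv_gauge_den_opp rho x :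
  (x - rho%:C) * (gauge_den rho (- x))^-1 = - (x + rho%:C) * (gauge_den rho x)^-1.
Proof.
rewrite /gauge_den !invfM (invGammaD1 (rho%:C - - x)) (invGammaD1 (rho%:C - x)).
have -> : rho%:C - - x + 1 = 1 + rho%:C + x by ring.
have -> : rho%:C - x + 1 = 1 + rho%:C - x by ring.
by ring.
Qed.

Definition flip b r := if b then - r else r.
Definition num_factor b r x := if b then gauge_num r x else 1.
Definition den_factor b rho x := if b then (gauge_den rho x)^-1 else 1.

(** The four bits tell which of rho1, rho2, r1, r2 change sign. *)
Definition flip_params (f : bool * bool * bool * bool) s : params R :=
  let: (a1, a2, b1, b2) := f in
  Params (flip a1 (rho1 s)) (flip a2 (rho2 s)) (flip b1 (r1 s)) (flip b2 (r2 s)).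

Definition flip_gauge (f : bool * bool * bool * bool) s x : R[i] :=
  let: (a1, a2, b1, b2) := f in
  num_factor b1 (r1 s) x * num_factor b2 (r2 s) x *
  (den_factor a1 (rho1 s) x * den_factor a2 (rho2 s) x).

Definition flip_gauge_defined (f : bool * bool * bool * bool) s x : Prop :=
  let: (a1, a2, b1, b2) := f in
  (b1 -> gauge_num_defined (r1 s) x) /\ (b2 -> gauge_num_defined (r2 s) x).

Lemma num_factor_opp b r x : num_factor b r (- x) = num_factor b r x.
Proof. by case: b; rewrite //= gauge_num_opp. Qed.

Lemma num_factor_shift b r x :
  (b -> gauge_num_defined r x) -> (b -> gauge_num_defined r (- x - 1)) ->
  (x - r%:C + 1 / 2) * num_factor b r (- x - 1) =
  (-1) ^+ b * (x - (flip b r)%:C + 1 / 2) * num_factor b r x.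
Proof.
case: b => /= [/(_ isT) dx /(_ isT) dx1|_ _]; last by rewrite expr0; ring.
by rewrite gauge_num_shift// rmorphN expr1 mulN1r opprK.
Qed.

Lemma den_factor_shift b rho x : den_factor b rho (- x - 1) = den_factor b rho x.
Proof. by case: b; rewrite //= inv_gauge_den_shift. Qed.

Lemma den_factor_opp b rho x :
  (x - rho%:C) * den_factor b rho (- x) =
  (-1) ^+ b * (x - (flip b rho)%:C) * den_factor b rho x.
Proof.
case: b => /=; last by rewrite expr0 mul1r.
by rewrite inv_gauge_den_opp rmorphN expr1 mulN1r opprK.
Qed.

(** Partial fractions, showing that only the product of the two parameters
    enters the polar part. *)
Lemma BI_alphaE s x : BI_regular x -> BI_alpha s x =
  - (x / 2) + ((rho1 s)%:C + (rho2 s)%:C) / 2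
  - (rho1 s)%:C * (rho2 s)%:C / (2 * x).
Proof. by move=> [/eqP x0 _]; rewrite /BI_alpha; field. Qed.

Lemma BI_regular_neq0 x : BI_regular x -> 2 * x + 1 != 0.
Proof.
move=> [_ /eqP x1]; apply: contra x1 => /eqP x1; apply/eqP.
have -> : x = (2 * x + 1 - 1) / 2 by field.
by rewrite x1; field.
Qed.

Lemma BI_betaE s x : BI_regular x -> BI_beta s x =
  (2 * x + 1) / 4 - ((r1 s)%:C + (r2 s)%:C) / 2
  + (r1 s)%:C * (r2 s)%:C / (2 * x + 1).
Proof.
by move=> /BI_regular_neq0 x2; rewrite /BI_beta; field.
Qed.

Lemma flip_sign b r : (-1) ^+ b * (flip b r)%:C = r%:C.
Proof. by case: b => /=; rewrite ?expr0 ?mul1r// expr1 mulN1r rmorphN opprK. Qed.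

Section Flips.
Variables (a1 a2 b1 b2 : bool).
Local Notation f := (a1, a2, b1, b2).

Lemma BI_alpha_flip s x :
  BI_alpha s x * flip_gauge f s (- x) =
  (-1) ^+ (a1 (+) a2) * BI_alpha (flip_params f s) x * flip_gauge f s x.
Proof.
rewrite /BI_alpha /flip_gauge /= !num_factor_opp.
set n1 := num_factor _ _ _; set n2 := num_factor _ _ _.
have d1 := den_factor_opp a1 (rho1 s) x; have d2 := den_factor_opp a2 (rho2 s) x.
set d := _ / (_ * x).
have -> : d * (n1 * n2 * (den_factor a1 (rho1 s) (- x) *
                          den_factor a2 (rho2 s) (- x))) =
  ((x - (rho1 s)%:C) * den_factor a1 (rho1 s) (- x)) *
  ((x - (rho2 s)%:C) * den_factor a2 (rho2 s) (- x)) * (n1 * n2) / (- 2 * x).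
  by rewrite /d; ring.
by rewrite d1 d2 signr_addb; ring.
Qed.

Lemma BI_beta_flip s x :
  flip_gauge_defined f s x -> flip_gauge_defined f s (- x - 1) ->
  BI_beta s x * flip_gauge f s (- x - 1) =
  (-1) ^+ (b1 (+) b2) * BI_beta (flip_params f s) x * flip_gauge f s x.
Proof.
move=> [dx1 dx2] [dy1 dy2].
rewrite /BI_beta /flip_gauge /= !den_factor_shift.
set n1 := den_factor _ _ _; set n2 := den_factor _ _ _.
have d1 := num_factor_shift dx1 dy1; have d2 := num_factor_shift dx2 dy2.
set d := _ / (2 * x + 1).
have -> : d * (num_factor b1 (r1 s) (- x - 1) *
               num_factor b2 (r2 s) (- x - 1) * (n1 * n2)) =
  ((x - (r1 s)%:C + 1 / 2) * num_factor b1 (r1 s) (- x - 1)) *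
  ((x - (r2 s)%:C + 1 / 2) * num_factor b2 (r2 s) (- x - 1)) *
  (n1 * n2) / (2 * x + 1).
  by rewrite /d; ring.
by rewrite d1 d2 signr_addb; ring.
Qed.

(** A single formula for the two cases of C_d, with e = 1 or -1. *)
Definition flip_const s : R :=
  let e := (-1) ^+ (a1 (+) a2) in
  let s' := flip_params f s in
  - ((rho1 s + rho2 s - e * (rho1 s' + rho2 s')) / 2)
  + (r1 s + r2 s - e * (r1 s' + r2 s') - (a1 (+) a2)%:R) / 2.

(** By the parity condition the flips multiply both rho1 rho2 and r1 r2 by e, so
    in e (alpha' + beta') - (alpha + beta) the polar parts cancel; the linear
    parts -x/2 and x/2 of alpha and beta cancel each other. *)
Lemma BI_coef_flip s x : a1 (+) a2 = b1 (+) b2 -> BI_regular x ->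
  (-1) ^+ (a1 (+) a2) *
    (BI_alpha (flip_params f s) x + BI_beta (flip_params f s) x) -
  (BI_alpha s x + BI_beta s x) = (flip_const s)%:C.
Proof.
move=> par xr; rewrite !BI_alphaE// !BI_betaE// /flip_const.
have rhoM : (-1) ^+ (a1 (+) a2) * ((flip a1 (rho1 s))%:C * (flip a2 (rho2 s))%:C)
            = (rho1 s)%:C * (rho2 s)%:C.
  by rewrite signr_addb mulrACA !flip_sign.
have rM : (-1) ^+ (a1 (+) a2) * ((flip b1 (r1 s))%:C * (flip b2 (r2 s))%:C)
          = (r1 s)%:C * (r2 s)%:C.
  by rewrite par signr_addb mulrACA !flip_sign.
have odd : ((a1 (+) a2)%:R : R) = (1 - (-1) ^+ (a1 (+) a2)) / 2.
  by case: (a1 (+) a2) => /=; field.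
rewrite -rhoM -rM odd.
rewrite !(realcD, realcN, realcM, realc_half, realc_sign, realc1).
have [/eqP x0 _] := xr; have x1 := BI_regular_neq0 xr.
move: ((-1) ^+ _) => e.
by field; rewrite x0 x1.
Qed.

(** The two quotients of the gauge factor have the common sign e by the parity
    condition, so e times the operator with flipped parameters factors out; its
    own zeroth order terms are compensated by the constant. *)
Lemma BI_op_flip s (g : R[i] -> R[i]) x : a1 (+) a2 = b1 (+) b2 ->
  BI_regular x ->
  flip_gauge_defined f s x -> flip_gauge_defined f s (- x - 1) ->
  BI_op s (fun y => flip_gauge f s y * g y) x =
  flip_gauge f s x * ((-1) ^+ (a1 (+) a2) * BI_op (flip_params f s) g x +
                      (flip_const s)%:C * g x).
Proof.
move=> par xr dx dx1; rewrite -(BI_coef_flip s par xr).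
have ha := BI_alpha_flip s x; have hb := BI_beta_flip dx dx1.
rewrite /BI_op /shift_op /reflect_op opprD !mulrBr.
rewrite (mulrA (BI_alpha s x) (flip_gauge f s (- x))) ha.
rewrite (mulrA (BI_beta s x) (flip_gauge f s (- x - 1))) hb -par.
by ring.
Qed.

(** The function is nonzero at some point i (k + 1), since a nonzero polynomial
    has finitely many roots and the gauge factor has no zero there. *)
Theorem flip_eigenfunction s n p : a1 (+) a2 = b1 (+) b2 ->
  is_BI_poly (flip_params f s) n p ->
  BI_eigenfunction s (flip_gauge_defined f s)
    (fun x => flip_gauge f s x * p.[x])
    ((-1) ^+ (a1 (+) a2) * BI_lambda (flip_params f s) n + flip_const s).
Proof.
move=> par [pm ps pe]; split; last first.
  move=> x xr dx _ dx1; rewrite BI_op_flip// pe//.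
  rewrite (realcD (_ * _)) (realcM (_ ^+ _)) realc_sign.
  by ring.
have p0 : p != 0 by rewrite monic_neq0.
have [k kp] : exists k : nat, ~~ root p (0 +i* k.+1%:R).
  apply: contrapT => nk.
  have := @max_poly_roots _ p [seq 0 +i* k.+1%:R | k <- iota 0 (size p)] p0.
  rewrite size_map size_iota ltnn => H; apply: (notF (H _ _)).
  - by apply/allP => _ /mapP[k _ ->]; apply: contrapT => /negP kp; apply: nk; exists k.
  - by rewrite map_inj_uniq ?iota_uniq// => i j [] /eqP; rewrite eqr_nat eqSS => /eqP.
pose x : R[i] := 0 +i* k.+1%:R.
have notpole (z : R[i]) : complex.Im z != 0 -> ~ Gamma_pole z.
  move=> z0 [j zj]; move: z0; rewrite zj -realc_nat /=.
  by rewrite oppr0 eqxx.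
have imx : complex.Im x != 0 by rewrite /= pnatr_eq0.
have npD (c : R) (z : R[i]) : z = c%:C + x \/ z = c%:C - x -> ~ Gamma_pole z.
  by move=> [] ->; apply: notpole; rewrite /= add0r ?oppr_eq0.
have half : (1 / 2 : R[i]) = (1 / 2)%:C by rewrite realcM realc1 realc_half.
have numd r : gauge_num_defined r x.
  by split; apply: (npD (1 / 2 + r)); rewrite half realcD; [left|right].
exists x; first by split.
apply/eqP; apply: mulf_neq0; last exact: kp.
have nf b r : num_factor b r x != 0.
  case: b => /=; last exact: oner_neq0.
  by have [] := numd r; rewrite /gauge_num => ? ?; rewrite mulf_neq0 ?Gamma_neq0.
have df b r : den_factor b r x != 0.
  case: b => /=; last exact: oner_neq0.
  rewrite invr_eq0 mulf_neq0 ?Gamma_neq0//.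
  - by apply: (npD r); right.
  - by apply: (npD (1 + r)); left; rewrite realcD realc1.
by rewrite /= !mulf_neq0.
Qed.

(** The index d enters only through the flips it stands for; that d > 4 exactly
    when one rho and one r are flipped accounts for the two cases in the formulas
    for the eigenvalue. *)
Lemma flip_quasi_eigenfunction s d n p :
  a1 (+) a2 = b1 (+) b2 -> (4 < d)%N = a1 (+) a2 ->
  sigma s d = flip_params f s ->
  (forall x, gauge s d x = flip_gauge f s x) ->
  (forall x, gauge_defined s d x <-> flip_gauge_defined f s x) ->
  is_BI_poly (sigma s d) n p ->
  BI_eigenfunction s (gauge_defined s d) (fun x => gauge s d x * p.[x])
    (quasi_eigenvalue s d n).
Proof.
move=> par dE sE gE gdE; rewrite sE => hp.
have -> : quasi_eigenvalue s d n =
    (-1) ^+ (a1 (+) a2) * BI_lambda (flip_params f s) n + flip_const s.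
  rewrite /quasi_eigenvalue /eigenvalue_const sE leqNgt dE /flip_const.
  by case: (a1 (+) a2) => /=; rewrite ?expr1 ?expr0; ring.
have -> : gauge_defined s d = flip_gauge_defined f s.
  by apply/funext => x; apply/propext.
under eq_fun do rewrite gE.
exact: flip_eigenfunction.
Qed.

End Flips.

End GaugeFactors.

Theorem theorem3p3 (R : realType) (rho1 rho2 r1 r2 : R) (d : nat)
    (hd : (1 <= d <= 8)%N)
    (hB : BI_well_defined (sigma (Params rho1 rho2 r1 r2) d)) (m : nat) :
  BI_eigenfunction (Params rho1 rho2 r1 r2)
    (gauge_defined (Params rho1 rho2 r1 r2) d)
    (fun x => (gauge (Params rho1 rho2 r1 r2) d x *
               (BI_poly (sigma (Params rho1 rho2 r1 r2) d) m).[x])%R)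
    (quasi_eigenvalue (Params rho1 rho2 r1 r2) d m).
Proof.
set s := Params rho1 rho2 r1 r2.
have hp : is_BI_poly (sigma s d) m (BI_poly (sigma s d) m).
  by case: (hB m) => p [pm _]; apply: (@xgetPex _ 0%R [set q | is_BI_poly (sigma s d) m q]); exists p.
case: d hd {hB} hp => [//|[|[|[|[|[|[|[|[|//]]]]]]]]] _ hp;
  [ apply: (@flip_quasi_eigenfunction _ false false false false) hp
  | apply: (@flip_quasi_eigenfunction _ true true true true) hp
  | apply: (@flip_quasi_eigenfunction _ true true false false) hp
  | apply: (@flip_quasi_eigenfunction _ false false true true) hp
  | apply: (@flip_quasi_eigenfunction _ true false true false) hp
  | apply: (@flip_quasi_eigenfunction _ false true false true) hp
  | apply: (@flip_quasi_eigenfunction _ false true true false) hp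
  | apply: (@flip_quasi_eigenfunction _ true false false true) hp ] => //= x;
  by [rewrite ?invfM ?mul1r ?mulr1 ?div1r | intuition].
Qed.
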